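(* Let $\mu\ge0$ and $\lambda\in\mathbb{R}$, and let $f(z)$ be an entire function with the representation $$f(z)=\int_0^1\cos(\lambda zt)\,g(t)\,dt,$$ where the function $g$ is non-negative and non-decreasing. Then the differential operator $f(D)$ maps $\mathcal{S}_\mu(\mathbb{R})$ into $\mathcal{S}_\delta(\mathbb{R})\cup\{0\}$, where $\delta=\sqrt{\max\{\mu^2-\lambda^2/4,0\}}$.
   Context: $D=d/dz$; for $f(z)=\sum c_kz^k$, $f(D)=\sum c_kD^k$ acting on polynomials. $\mathcal{S}_\mu(\mathbb{R})$ is the set of (nonzero) real polynomials all of whose zeros lie in $|\operatorname{Im}z|\le\mu$. *)

(* Defs.v *)
From HB Require Import structures.
From mathcomp Require Import all_boot all_order all_algebra.
From mathcomp Require Import complex.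
From mathcomp Require Import all_classical all_reals all_analysis.

Set Implicit Arguments.
Unset Strict Implicit.
Unset Printing Implicit Defensive.

Import Order.TTheory GRing.Theory Num.Theory.
Import numFieldNormedType.Exports.

Local Open Scope complex_scope.
Local Open Scope ring_scope.
Local Open Scope classical_set_scope.

Definition cexp (R : realType) (z : R[i]) : R[i] :=
  (expR (complex.Re z))%:C * (cos (complex.Im z) +i* sin (complex.Im z)).

Definition ccos (R : realType) (z : R[i]) : R[i] :=
  (cexp ('i%C * z) + cexp (- ('i%C * z))) / 2.

(* Meaningful when the real and imaginary parts of F are integrable on D. *)
Definition Cintegral (R : realType) (D : set R) (F : R -> R[i]) : R[i] :=
  Rintegral lebesgue_measure D (fun t => complex.Re (F t)) +i*
  Rintegral lebesgue_measure D (fun t => complex.Im (F t)).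

(* f is the entire function with Taylor coefficients c at the origin:
   convergence is required at every point of the complex plane, in the
   topology given by the complex modulus. *)
Definition entire_with_coefs (R : realType) (f : R[i] -> R[i])
    (c : nat -> R[i]) : Prop :=
  forall z : R[i], series (fun k => c k * z ^+ k : R[i]^o) @ \oo --> (f z : R[i]^o).

(* The series \sum_k c_k D^k applied to p; the terms of index k >= size p
   vanish. *)
Definition diffop (R : realType) (c : nat -> R[i]) (p : {poly R[i]}) :
    {poly R[i]} :=
  \sum_(k < size p) c k *: p^`(k).

Definition poly_toC (R : realType) (p : {poly R}) : {poly R[i]} :=
  map_poly (real_complex R) p.

Definition strip_polys (R : realType) (mu : R) : set {poly R} :=
  [set p | p != 0 /\
    forall z : R[i], root (poly_toC p) z -> `|complex.Im z| <= mu].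

(* Main.v *)
Require Import Defs.
From HB Require Import structures.
From mathcomp Require Import all_boot all_order all_algebra.
From mathcomp Require Import complex.
From mathcomp Require Import all_classical all_reals all_analysis.
From mathcomp Require Import measurable_realfun ring lra.

Set Implicit Arguments.
Unset Strict Implicit.
Unset Printing Implicit Defensive.

Import Order.TTheory GRing.Theory Num.Theory.
Import numFieldNormedType.Exports.

Local Open Scope complex_scope.
Local Open Scope ring_scope.
Local Open Scope classical_set_scope.

(** Let [m_k] be the moments of [g] on [0, 1] and let [Phi] be the linear
    functional on complex polynomials with [Phi(X^k) = m_k].  Comparing Taylor
    coefficients of [f], [2 f(D)p(z) = Phi(p(z + i l X)) + Phi(p(z - i l X))]
    with [l = |lambda|].

    Since [g] is non-negative and non-decreasing, [int g q' >= 0] whenever the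
    real polynomial [q] attains its maximum over [0, 1] at [1] (layer cake).
    Taking [q] to be the real part of a multiple of [(X - tau)^(k+1)] gives
    [Phi((X - tau)^k) <> 0] for [Re tau < 1/2].  A Grace-Walsh type argument
    extends this to [Phi(h) <> 0] for every nonzero [h] with all its roots in
    [Re < 1/2].

    If [f(D)p] vanishes at [z = x + i y] with [y > delta], the two terms above
    have equal moduli, because they are [Phi(A)] and the conjugate of [Phi(B)]
    with [A = p(z + i l X)] and [B = p(conj z + i l X)].  So
    [Phi(A + e B) = 0] for some unimodular [e].  But de Bruijn's inequality
    gives [|A(tau)| > |B(tau)|] as soon as [Re tau >= 1/2], so the roots of
    [A + e B] have [Re < 1/2], a contradiction. *)

(** * Logarithmic derivatives of split polynomials, and inverses of complex numbers *)

Lemma horner_deriv_prod_XsubC (F : fieldType) (rs : seq F) (x : F) :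
  x \notin rs ->
  (deriv (\prod_(a <- rs) ('X - a%:P))).[x] =
  (\prod_(a <- rs) ('X - a%:P)).[x] * \sum_(a <- rs) (x - a)^-1.
Proof.
elim: rs => [|a rs IH]; first by rewrite !big_nil derivC hornerC mulr0.
rewrite inE negb_or => /andP[xa xrs]; rewrite !big_cons derivM derivXsubC mul1r.
rewrite hornerD !hornerM IH // hornerXsubC mulrDr mulrAC mulfV ?mul1r ?subr_eq0 //.
by rewrite mulrA.
Qed.

Section RealComplex.
Variable R : rcfType.
Implicit Types (z w : R[i]).

Lemma Re_invc z : complex.Re z^-1 =
  complex.Re z / (complex.Re z ^+ 2 + complex.Im z ^+ 2).
Proof. by case: z. Qed.

Lemma Im_invc z : complex.Im z^-1 =
  - (complex.Im z / (complex.Re z ^+ 2 + complex.Im z ^+ 2)).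
Proof. by case: z. Qed.

Lemma sqr_normC_gt0 z :
  (0 < complex.Re z ^+ 2 + complex.Im z ^+ 2) = (z != 0).
Proof.
by rewrite -ltcR add_Re2_Im2 lt0r expf_eq0 normr_eq0 /= exprn_ge0 ?andbT.
Qed.

End RealComplex.

(** * Grace-Walsh argument in a half-plane *)

Section HalfPlane.
Variable R : rcfType.
Implicit Types (z w t : R[i]) (s : R).

(** Since [Re (1/z) = Re z * |1/z|^2], inversion sends the half-plane [Re <= -b] into the disc with
    diameter [[-1/b, 0]]. *)
Lemma invc_disc z (b : R) : 0 < b -> complex.Re z <= - b ->
  complex.Re z^-1 <= - b * (complex.Re z^-1 ^+ 2 + complex.Im z^-1 ^+ 2).
Proof.
move=> b0 zb; rewrite Re_invc Im_invc.
have z0 : z != 0 by apply/negP => /eqP z0; move: zb; rewrite z0 /= lerNr oppr0 leNgt b0.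
have N0 := z0; rewrite -sqr_normC_gt0 in N0.
set N := (X in _ / X) in N0 *.
have -> : (complex.Re z / N) ^+ 2 + (- (complex.Im z / N)) ^+ 2 = N^-1.
  rewrite sqrrN !exprMn -mulrDl exprVn -/N.
  by field; rewrite gt_eqF.
by rewrite ler_wpM2r // invr_ge0 ltW.
Qed.

(** Convexity of that disc: sum the tangent bounds [|w|^2 >= 2 Re (conj m * w) - |m|^2]. When [m] is
    the mean of the [w], the result places [m] in the disc again. *)
Lemma disc_sum (ws : seq R[i]) (b : R) m : 0 < b ->
  (forall w, w \in ws ->
    complex.Re w <= - b * (complex.Re w ^+ 2 + complex.Im w ^+ 2)) ->
  complex.Re (\sum_(w <- ws) w) <=
  - b * (2 * (complex.Re m * complex.Re (\sum_(w <- ws) w)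
            + complex.Im m * complex.Im (\sum_(w <- ws) w))
         - (size ws)%:R * (complex.Re m ^+ 2 + complex.Im m ^+ 2)).
Proof.
move=> b0; elim: ws => [|w ws IH] H.
  by rewrite !big_nil /= !mulr0 mul0r addr0 mulr0 subr0 mulr0.
have Hw := H w (mem_head _ _).
have {IH H} := IH (fun v hv => H v (mem_behead (s := w :: ws) hv)).
rewrite !big_cons; move: (\sum_(j <- ws) j) => S.
rewrite [size (w :: ws)]/= -[(size ws).+1%:R]natr1.
move: (size ws)%:R => n; move: m w S Hw => [m1 m2] [w1 w2] [S1 S2] /= Hw IH.
have : 0 <= b * ((w1 - m1) ^+ 2 + (w2 - m2) ^+ 2).
  by rewrite mulr_ge0 ?(ltW b0) // addr_ge0 ?sqr_ge0.
by lra.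
Qed.

End HalfPlane.

Section Shift.
Variables (F : fieldType) (Phi : {scalar {poly F}}).
Implicit Types t : F.

(** The binomial expansion of [Phi (('X - t%:P) ^+ d)], read as a polynomial in [t]. *)
Definition pow_poly (d : nat) : {poly F} :=
  \poly_(j < d.+1) ((-1) ^+ j * 'C(d, j)%:R * Phi 'X^(d - j)).

Lemma horner_pow_poly d t : (pow_poly d).[t] = Phi (('X - t%:P) ^+ d).
Proof.
rewrite horner_poly exprBn linear_sum /=; apply: eq_bigr => j _.
have -> : (-1) ^+ j * 'X^(d - j) * t%:P ^+ j *+ 'C(d, j) =
    ((-1) ^+ j * 'C(d, j)%:R * t ^+ j) *: 'X^(d - j).
  rewrite -mul_polyC !polyCM !polyC_exp polyCN -mulr_natr polyC1.
  by rewrite -(polyC_natr _ 'C(d, j)); ring.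
by rewrite linearZ /= mulrAC.
Qed.

Lemma deriv_pow_poly d : deriv (pow_poly d.+1) = - (d.+1%:R *: pow_poly d).
Proof.
apply/polyP => j; rewrite coef_deriv coefN coefZ !coef_poly ltnS.
case: ifP => jd; last by rewrite mulr0 oppr0 mul0rn.
rewrite subSS -mulr_natr.
have := congr1 (fun n : nat => n%:R : F) (mul_bin_diag d.+1 j).
rewrite !natrM /= => H.
rewrite exprS.
transitivity (- ((-1) ^+ j *
    ((j.+1%:R * 'C(d.+1, j.+1)%:R) * Phi 'X^(d - j)))); first by ring.
by rewrite -H; ring.
Qed.

Lemma size_pow_poly d : Phi 1 != 0 -> size (pow_poly d) = d.+1.
Proof.
move=> H; rewrite size_poly_eq // subnn expr0 binn mulr1 mulf_neq0 //.
by rewrite signr_eq0.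
Qed.
End Shift.

(** Absorbing a factor into the functional lets the Grace-Walsh induction treat the roots of [h] one
    at a time. *)
Definition premul (F : fieldType) (Phi : {scalar {poly F}}) (q h : {poly F}) : F :=
  Phi (q * h).

Lemma premul_is_scalar (F : fieldType) (Phi : {scalar {poly F}}) q :
  scalar (premul Phi q).
Proof. by move=> a u v; rewrite /premul mulrDr -scalerAr linearP. Qed.

HB.instance Definition _ (F : fieldType) (Phi : {scalar {poly F}}) q :=
  GRing.isLinear.Build F {poly F} F *%R (premul Phi q) (premul_is_scalar Phi q).

Section Grace.
Variable R : rcfType.
Implicit Types (s : R) (t : R[i]).

Definition nonvanishing_powers s (Phi : {scalar {poly R[i]}}) :=
  forall k t, complex.Re t < s -> Phi (('X - t%:P) ^+ k) != 0.

(** Laguerre's argument. Let [Q(t) = Phi((X - t)^(k+1))], whose roots all satisfy [Re >= s]. If the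
    new functional killed [(X - t)^k], then [1/(t - t1)] would be the mean of the [1/(t - a)] over
    the roots [a] of [Q], and convexity of the disc would force [Re t1 >= s]. *)
Lemma nonvanishing_premul s (Phi : {scalar {poly R[i]}}) t1 :
  nonvanishing_powers s Phi -> complex.Re t1 < s ->
  nonvanishing_powers s (premul Phi ('X - t1%:P)).
Proof.
move=> NPhi t1s k t ts; apply/negP => /eqP PhiE.
have {PhiE} : Phi (('X - t1%:P) * ('X - t%:P) ^+ k) = 0 by exact: PhiE.
have -> : 'X - t1%:P = ('X - t%:P) + (t - t1)%:P by rewrite polyCB; ring.
rewrite mulrDl -exprS linearD mul_polyC linearZ /= => PhiE.
have Phi1 : Phi 1 != 0 by rewrite -(expr0 ('X - t%:P)) NPhi.
have [rs Qrs] := closed_field_poly_normal (pow_poly Phi k.+1).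
set Q := pow_poly _ _ in Qrs.
have Qt u : Q.[u] = Phi (('X - u%:P) ^+ k.+1) by exact: horner_pow_poly.
have szQ : size Q = k.+2 by apply: size_pow_poly.
have lc0 : lead_coef Q != 0 by rewrite lead_coef_eq0 -size_poly_gt0 szQ.
have szrs : size rs = k.+1.
  by move: szQ; rewrite Qrs size_scale // size_prod_XsubC => -[].
have rsP u : u \in rs -> s <= complex.Re u.
  move=> urs; rewrite leNgt; apply/negP => us.
  have /negP := NPhi k.+1 _ us; apply; rewrite -Qt -rootE Qrs rootZ //.
  by rewrite root_prod_XsubC.
have trs : t \notin rs by apply/negP => /rsP; rewrite leNgt ts.
have Qt0 : Q.[t] != 0 by rewrite Qt NPhi.
have := congr1 (fun p => p.[t]) (deriv_pow_poly Phi k); rewrite -/Q.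
rewrite {1}Qrs derivZ hornerZ horner_deriv_prod_XsubC // mulrA -hornerZ -Qrs.
rewrite hornerN hornerZ horner_pow_poly.
set S := \sum_(a <- rs) _ => QS.
(* [Q'(t) = Q(t) * S] also equals [-(k+1) Phi((X - t)^k)]; by [PhiE] its product with [t - t1] is
   [(k+1) Q(t)]. *)
have S_eq : (t - t1) * S = k.+1%:R.
  apply: (mulfI Qt0); rewrite mulrCA Qt QS horner_pow_poly.
  move/eqP: PhiE; rewrite addr_eq0 => /eqP ->; ring.
have tt1 : t - t1 != 0.
  by apply/negP => /eqP tt1; move/eqP: S_eq; rewrite tt1 mul0r eq_sym pnatr_eq0.
have S_m : S = k.+1%:R * (t - t1)^-1 by rewrite -S_eq mulrAC mulfV // mul1r.
(* [b] is the distance from [t] to the line [Re = s], so [Re (t - a) <= -b] for each root [a], while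
   [Re (t - t1) > -b]. *)
pose b : R := s - complex.Re t.
have b0 : 0 < b by rewrite subr_gt0.
have inv_rs w : w \in [seq (t - a)^-1 | a <- rs] ->
    complex.Re w <= - b * (complex.Re w ^+ 2 + complex.Im w ^+ 2).
  move=> /mapP[a /rsP sa ->]; apply: invc_disc => //.
  by case: (t) (a) sa @b b0 => [x y] [x' y'] /=; lra.
have := disc_sum (t - t1)^-1 b0 inv_rs.
rewrite big_map size_map -/S szrs.
have D_b : - (s - complex.Re t) < complex.Re (t - t1).
  by case: (t) (t1) t1s => [x y] [x' y'] /=; lra.
rewrite -/b in D_b; rewrite S_m; apply/negP; rewrite -ltNge.
have N0 := tt1; rewrite -sqr_normC_gt0 in N0.
have n0 : (0 : R) < k.+1%:R by rewrite ltr0n.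
rewrite -(rmorph_nat (real_complex R)).
have := Re_invc (t - t1); have := Im_invc (t - t1).
case: (t - t1)^-1 => m1 m2; case: (t - t1) D_b N0 => x y /= xb N0 -> ->.
move: (k.+1%:R) n0 => n n0; rewrite !mul0r subr0 addr0.
set N := _ + _ in N0 *.
have -> : - b * (2 * (x / N * (n * (x / N)) + - (y / N) * (n * - (y / N))) -
    n * ((x / N) ^+ 2 + (- (y / N)) ^+ 2)) = n * N^-1 * - b.
  transitivity (- b * n * (x ^+ 2 + y ^+ 2) * N^-1 ^+ 2); first by ring.
  by rewrite -/N; field; rewrite gt_eqF.
rewrite [n * (x / N)](_ : _ = n * N^-1 * x); last by ring.
by rewrite ltr_pM2l // mulr_gt0 // invr_gt0.
Qed.

Theorem scalar_neq0_of_roots s (Phi : {scalar {poly R[i]}}) (h : {poly R[i]}) :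
  nonvanishing_powers s Phi -> h != 0 ->
  (forall t, root h t -> complex.Re t < s) -> Phi h != 0.
Proof.
move=> NPhi h0; have [rs ->] := closed_field_poly_normal h.
have lc0 : lead_coef h != 0 by rewrite lead_coef_eq0.
move=> rsP; rewrite linearZ mulf_neq0 //.
have {rsP} : forall t, t \in rs -> complex.Re t < s.
  by move=> t trs; apply: rsP; rewrite rootZ // root_prod_XsubC.
elim: rs Phi NPhi => [|a rs IH] Phi NPhi rsP.
  (* The empty product is the zeroth power at [s - 1], a point of the half-plane. *)
  by rewrite big_nil -(expr0 ('X - (s - 1)%:C%:P)) NPhi //= gtrBl.
rewrite big_cons; apply: (IH (premul Phi ('X - a%:P))).
  by apply: nonvanishing_premul => //; apply: rsP; rewrite mem_head.
by move=> t trs; apply: rsP; rewrite inE trs orbT.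
Qed.

End Grace.

(** * De Bruijn's inequality *)

Lemma conjc_horner_toC (R : realType) (p : {poly R}) (z : R[i]) :
  ((poly_toC p).[z])^* = (poly_toC p).[z^*].
Proof.
rewrite -horner_map /=; congr (_.[_]); apply/polyP => k.
rewrite !coef_map /=; exact: conjc_real.
Qed.

Lemma root_toC_conj (R : realType) (p : {poly R}) (z : R[i]) :
  root (poly_toC p) z^* = root (poly_toC p) z.
Proof. by rewrite !rootE -conjc_horner_toC conjc_eq0. Qed.

(** The contribution of one root, with [z] paired with its conjugate so that [w] and [conj w] are
    treated together: the squares differ by [8 * Im z * y * ((Re z - Re w)^2 + Im z^2 + y^2 - Im
    w^2)]. *)
Lemma normC_prod_lt (R : realType) (z w : R[i]) (y : R) :
  0 < complex.Im z -> 0 < y ->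
  complex.Im w ^+ 2 < complex.Im z ^+ 2 + y ^+ 2 ->
  `|z - 'i * y%:C - w| * `|(z - 'i * y%:C)^* - w|
    < `|z + 'i * y%:C - w| * `|(z + 'i * y%:C)^* - w|.
Proof.
move=> z0 y0 wzy.
rewrite -ltr_sqr ?nnegrE ?mulr_ge0 //.
rewrite !exprMn -!add_Re2_Im2 -!rmorphM ltcR /=.
case: z w z0 wzy => [z1 z2] [w1 w2] /= z0 wzy.
rewrite -subr_gt0.
rewrite [X in 0 < X](_ : _ =
  8 * z2 * y * ((z1 - w1) ^+ 2 + z2 ^+ 2 + y ^+ 2 - w2 ^+ 2)); last by ring.
by rewrite !mulr_gt0 //; have := sqr_ge0 (z1 - w1); lra.
Qed.

(** For real [p], [|p(w)|^2 = |p(w)| |p(conj w)|], so the one-root inequality can be multiplied over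
    all roots without matching conjugate pairs; [1 < size p] provides a root, hence strictness. *)
Lemma normC_toC_lt (R : realType) (p : {poly R}) (mu y : R) (z : R[i]) :
  (1 < size p)%N -> strip_polys mu p -> 0 < complex.Im z -> 0 < y ->
  mu ^+ 2 < complex.Im z ^+ 2 + y ^+ 2 ->
  `|(poly_toC p).[z - 'i * y%:C]| < `|(poly_toC p).[z + 'i * y%:C]|.
Proof.
move=> szp [p0 pmu] z0 y0 muzy.
have P0 : poly_toC p != 0 by rewrite map_poly_eq0.
have szP : size (poly_toC p) = size p by exact: size_map_poly.
rewrite -ltr_sqr ?nnegrE //.
have sqrE w : `|(poly_toC p).[w]| ^+ 2 =
    `|(poly_toC p).[w]| * `|(poly_toC p).[w^*]|.
  by rewrite -conjc_horner_toC normcJ.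
rewrite !sqrE.
have [rs Prs] := closed_field_poly_normal (poly_toC p).
have lc0 : lead_coef (poly_toC p) != 0 by rewrite lead_coef_eq0.
have rsP u : u \in rs -> `|complex.Im u| <= mu.
  by move=> urs; apply: pmu; rewrite Prs rootZ // root_prod_XsubC.
have szrs : (0 < size rs)%N.
  by move: szp; rewrite -szP {1}Prs size_scale // size_prod_XsubC.
have normE w : `|(poly_toC p).[w]| * `|(poly_toC p).[w^*]| =
    `|lead_coef (poly_toC p)| ^+ 2 * \prod_(a <- rs) (`|w - a| * `|w^* - a|).
  move: (lead_coef _) Prs => lc ->.
  rewrite !hornerZ !horner_prod !normrM !normr_prod mulrACA -expr2 -big_split /=.
  by congr (_ * _); apply: eq_bigr => a _; rewrite !hornerXsubC.
rewrite !normE ltr_pM2l ?exprn_gt0 ?normr_gt0 // big_seq [ltRHS]big_seq.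
apply: ltr_prod => [|a ars].
  by case: (rs) szrs => [//|a r] _; rewrite /= mem_head.
rewrite mulr_ge0 //=; apply: normC_prod_lt => //.
apply: le_lt_trans muzy; rewrite -real_normK ?num_real // lerXn2r ?nnegrE //.
  exact: le_trans (rsP _ ars).
exact: rsP.
Qed.

(** * Integrals against a monotone weight *)

Lemma sum_natr_le (R : realType) (x : R) N : 0 <= x ->
  \sum_(j < N) ((j.+1%:R <= x)%R%:R : R) = (minn N (Num.trunc x))%:R.
Proof.
move=> x0; elim: N => [|N IH]; first by rewrite big_ord0 min0n.
rewrite big_ord_recr /= IH -truncn_gt_nat -natrD; congr _%:R.
case: ltnP => h; first by rewrite (minn_idPl h) addn1.
by rewrite (minn_idPr (leqW h)) addn0.
Qed.

(** Discrete layer cake: the levels [(j+1)/(n+1)] reach up to [n+1], so once [y < n+1] the sum is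
    [trunc ((n+1) y)] and the error is at most [1/(n+1)]. *)
Lemma cvg_level_sum (R : realType) (y : R) : 0 <= y ->
  n.+1%:R^-1 * (\sum_(j < n.+1 * n.+1) ((j.+1%:R <= n.+1%:R * y)%R%:R : R))
    @[n --> \oo] --> y.
Proof.
move=> y0.
apply: (@squeeze_cvgr _ _ _ _ (fun n => y - n.+1%:R^-1) (fun=> y)); last 2 first.
- rewrite -[X in _ --> X]subr0; apply: cvgB; first exact: cvg_cst.
  exact: cvg_harmonic.
- exact: cvg_cst.
near=> n.
have n0 : (0 : R) < n.+1%:R by rewrite ltr0n.
have ny0 : 0 <= n.+1%:R * y by rewrite mulr_ge0 // ltW.
rewrite sum_natr_le //.
have ny : y < n.+1%:R.
  have /andP[_ /lt_le_trans] := truncn_itv y0; apply; rewrite ler_nat ltnS.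
  by near: n; exact: nbhs_infty_ge.
have /minn_idPr -> : (Num.trunc (n.+1%:R * y) <= n.+1 * n.+1)%N.
  rewrite -(ler_nat R) natrM (le_trans (y := n.+1%:R * y)) //.
    by rewrite truncn_le.
  by rewrite ler_wpM2l // ltW.
have /andP[t1 t2] := truncn_itv ny0.
rewrite [_^-1 * _]mulrC; apply/andP; split.
  rewrite ler_pdivlMr // mulrBl mulVf ?gt_eqF // mulrC lerBlDr natr1.
  exact: ltW.
by rewrite ler_pdivrMr // [y * _]mulrC.
Unshelve. all: by end_near. Qed.

Section TailIntegral.
Variable R : realType.
Notation mu := (@lebesgue_measure R).
Implicit Types (q : {poly R}) (g : R -> R) (A : set R).

Lemma integral_deriv_horner q (a b : R) : a < b ->
  (\int[mu]_(x in `[a, b]) ((deriv q).[x])%:E = (q.[b] - q.[a])%:E)%E.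
Proof.
move=> ab; rewrite (@continuous_FTC2 _ _ (horner q)) ?EFinB //.
- by apply/continuous_subspaceT => x; exact: continuous_horner.
- split=> [x _| |].
  + exact: derivable_horner.
  + by apply: cvg_at_right_filter; exact: continuous_horner.
  + by apply: cvg_at_left_filter; exact: continuous_horner.
- by move=> x _; rewrite -derivE.
Qed.

(** Unless empty, [A] is an interval ending at 1, open or closed on the left, so the integral is
    [q(1) - q(inf A)]. *)
Lemma integral_deriv_tail q A :
  A `<=` `]0, 1[ ->
  (forall s t, A s -> s <= t -> t < 1 -> A t) ->
  (forall s, 0 <= s <= 1 -> q.[s] <= q.[1]) ->
  (0 <= \int[mu]_(x in A) ((deriv q).[x])%:E)%E.
Proof.
move=> A01 Aup q1.
have [->|/set0P[x0 Ax0]] := eqVneq A set0; first by rewrite integral_set0.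
have lbA : lbound A 0 by move=> x /A01; rewrite /= in_itv /= => /andP[/ltW].
have s0 : 0 <= inf A by apply: lb_le_inf => //; exists x0.
have s1 : inf A < 1.
  apply: (@le_lt_trans _ _ x0); first by apply: ge_inf => //; exists 0.
  by have := A01 _ Ax0; rewrite /= in_itv /= => /andP[].
have qint : (0 <= \int[mu]_(x in `[inf A, 1%R]) ((deriv q).[x])%:E)%E.
  by rewrite integral_deriv_horner // lee_fin subr_ge0 q1 // s0 ltW.
have mq (B : set R) : measurable_fun B (EFin \o horner (deriv q)).
  by apply/measurable_EFinP; exact: measurable_poly.
have gtA x : inf A < x -> x < 1 -> A x.
  move=> /(inf_lt (ex_intro _ x0 Ax0))[y Ay yx] x1; exact: Aup (ltW yx) x1.
have [Ai|nAi] := pselect (A (inf A)).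
  rewrite (_ : A = `[inf A, 1[) ?integral_itv_bndo_bndc //.
  apply/seteqP; split=> x /=; rewrite in_itv /=.
    move=> Ax; rewrite ge_inf //=; last by exists 0.
    by have := A01 _ Ax; rewrite /= in_itv /= => /andP[].
  by case/andP => ix x1; exact: Aup ix x1.
rewrite (_ : A = `]inf A, 1[) ?integral_itv_bndo_bndc ?integral_itv_obnd_cbnd //.
apply/seteqP; split=> x /=; rewrite in_itv /=.
  move=> Ax; apply/andP; split.
    rewrite lt_neqAle ge_inf ?andbT //; last by exists 0.
    by apply/negP => /eqP xE; apply: nAi; rewrite xE.
  by have := A01 _ Ax; rewrite /= in_itv /= => /andP[].
by case/andP; exact: gtA.
Qed.

End TailIntegral.

Section MonotoneIntegral.
Variable R : realType.
Notation mu := (@lebesgue_measure R).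
Implicit Types (q : {poly R}) (g : R -> R).

Lemma normr_horner_le q (x : R) : 0 <= x <= 1 ->
  `|q.[x]| <= \sum_(k < size q) `|q`_k|.
Proof.
move=> /andP[x0 x1]; rewrite horner_coef; apply: le_trans (ler_norm_sum _ _ _) _.
apply: ler_sum => k _; rewrite normrM ler_piMr // normrX ger0_norm //.
exact: exprn_ile1.
Qed.

Lemma integrable_mul_bounded (D : set R) (g h : R -> R) (M : R) : measurable D ->
  mu.-integrable D (EFin \o g) -> measurable_fun D h ->
  (forall x, D x -> `|h x| <= M) ->
  mu.-integrable D (EFin \o (fun x => h x * g x)).
Proof.
move=> mD ig mh hM.
have := @integrableMr _ _ R mu D mD h (EFin \o g) mh.
move=> /(_ _ ig); apply.
exists M; split; first exact: num_real.
by move=> N MN x Dx; apply: le_trans (hM x Dx) (ltW MN).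
Qed.

(** [g] is a dominated limit of nonnegative combinations of indicators of superlevel sets. As [g] is
    non-decreasing, these are tails of []0, 1[], and each contributes a nonnegative amount. *)
Lemma integral_deriv_monotone_ge0 q g :
  mu.-integrable (`]0, 1[ : set R) (EFin \o g) ->
  (forall t : R, 0 < t < 1 -> 0 <= g t) ->
  (forall s t : R, 0 < s -> s <= t -> t < 1 -> g s <= g t) ->
  (forall s, 0 <= s <= 1 -> q.[s] <= q.[1]) ->
  (0 <= \int[mu]_(x in `]0%R, 1%R[) ((deriv q).[x] * g x)%:E)%E.
Proof.
move=> ig g0 gnd q1.
(* [A n j] is the superlevel set [g >= (j+1)/(n+1)], and [w n] is the step function below [g] built
   from these levels. *)
pose A n (j : nat) := (`]0, 1[ : set R) `&` [set x | j.+1%:R <= n.+1%:R * g x].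
pose w n x : R := n.+1%:R^-1 *
  (\sum_(j < n.+1 * n.+1) ((j.+1%:R <= n.+1%:R * g x)%R%:R : R)).
have mg : measurable_fun (`]0, 1[ : set R) g.
  by apply/measurable_EFinP; case/integrableP: ig.
have mA n j : measurable (A n j).
  rewrite /A; apply: (measurable_fun_le (f := cst _)) => //.
  by apply: measurable_funM => //.
have w_ge0 n x : 0 <= w n x by rewrite mulr_ge0 ?invr_ge0 // sumr_ge0.
have w_le n x : 0 < x < 1 -> w n x <= g x.
  move=> /g0 gx0; rewrite /w sum_natr_le ?mulr_ge0 //.
  rewrite mulrC ler_pdivrMr ?ltr0n //.
  apply: (le_trans (y := (Num.trunc (n.+1%:R * g x))%:R)).
    by rewrite ler_nat geq_minr.
  by rewrite mulrC truncn_le mulr_ge0.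
have wE n x : 0 < x < 1 -> ((deriv q).[x] * w n x)%:E =
    (\sum_(j < n.+1 * n.+1) (n.+1%:R^-1)%:E *
      ((fun x => ((deriv q).[x])%:E) \_ (A n j)) x)%E.
  move=> x01; rewrite /w mulrCA mulr_sumr mulr_sumr -sumEFin.
  apply: eq_bigr => j _; rewrite EFinM; congr (_ * _)%E.
  rewrite patchE; case: ifPn => [|/negP nA].
    by rewrite inE => -[_ /= ->]; rewrite mulr1.
  case: leP => [le_j|]; last by rewrite mulr0.
  by exfalso; apply: nA; rewrite inE; split => //=; rewrite in_itv.
pose M := \sum_(k < size (deriv q)) `|(deriv q)`_k|.
have qM x : 0 < x < 1 -> `|(deriv q).[x]| <= M.
  by move=> /andP[x0 x1]; apply: normr_horner_le; rewrite !ltW.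
have iq0 : mu.-integrable (`]0, 1[ : set R) (EFin \o horner (deriv q)).
  apply: measurable_bounded_integrable => //.
  - by rewrite /= lebesgue_measure_itv /= lte01 oppr0 adde0 ltry.
  - exact: measurable_poly.
  - exists M; split; first exact: num_real.
    move=> N MN x /=; rewrite in_itv /= => x01.
    exact: le_trans (qM _ x01) (ltW MN).
have iq n j : mu.-integrable (`]0, 1[ : set R)
    ((fun x => ((deriv q).[x])%:E) \_ (A n j)).
  apply/integrable_restrict => //; first exact: mA.
  apply: integrableS iq0 => //.
  by apply: measurableI => //; exact: mA.
have iw n : mu.-integrable (`]0, 1[ : set R)
    (fun x => ((deriv q).[x] * w n x)%:E).
  have isum : mu.-integrable (`]0, 1[ : set R)
      (fun x => (\sum_(j < n.+1 * n.+1) (n.+1%:R^-1)%:E *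
        ((fun x => ((deriv q).[x])%:E) \_ (A n j)) x)%E).
    by apply: integrable_sum => // j _; apply: integrableZl => //; exact: iq.
  apply: (eq_integrable _ _ _ _ isum) => //.
  by move=> x; rewrite inE /= in_itv /= => /wE ->.
have w_int n : (0 <= \int[mu]_(x in `]0%R, 1%R[) ((deriv q).[x] * w n x)%:E)%E.
  have -> : (\int[mu]_(x in `]0%R, 1%R[) ((deriv q).[x] * w n x)%:E =
      \int[mu]_(x in `]0%R, 1%R[) (\sum_(j < n.+1 * n.+1) (n.+1%:R^-1)%:E *
        ((fun x => ((deriv q).[x])%:E) \_ (A n j)) x))%E.
    by apply: eq_integral => x; rewrite inE /= in_itv /= => /wE ->.
  rewrite integral_sum //; last by move=> j; apply: integrableZl.
  apply: sume_ge0 => j _; rewrite integralZl // mule_ge0 ?lee_fin ?invr_ge0 //.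
  rewrite -integral_mkcondr setIA setIid; apply: integral_deriv_tail => //.
  move=> s t [/=]; rewrite in_itv /= => /andP[s0 s1] js st t1.
  rewrite /A /= in_itv /= t1 (lt_le_trans s0 st); split => //.
  by apply: le_trans js _; rewrite ler_wpM2l // gnd.
(* Since [0 <= w n <= g] and [|q'| <= M], the function [M * g] dominates. *)
have [] := @dominated_convergence _ _ R mu (`]0, 1[ : set R) _
  (fun n x => ((deriv q).[x] * w n x)%:E) (fun x => ((deriv q).[x] * g x)%:E)
  (fun x => (M * g x)%:E).
- by [].
- by move=> n; exact: measurable_int (iw n).
- apply/measurable_EFinP; apply: measurable_funM => //; exact: measurable_poly.
- apply: aeW => x; rewrite /= in_itv /= => x01.
  apply/cvg_EFin; first by apply: nearW.
  by apply: cvgM; [exact: cvg_cst|apply: cvg_level_sum; exact: g0].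
- exact: (integrableZl _ M ig).
- apply: aeW => x n; rewrite /= in_itv /= => x01.
  rewrite lee_fin normrM ler_pM // ?qM // ger0_norm // w_le //.
move=> _ _ cvg_int.
rewrite -(cvg_lim _ cvg_int) //; apply: lime_ge.
  by apply/cvg_ex; eexists; exact: cvg_int.
exact: nearW.
Qed.

End MonotoneIntegral.

(** * The moment functional *)

Definition coef_functional (K : comNzRingType) (m : nat -> K) (p : {poly K}) : K :=
  \sum_(k < size p) p`_k * m k.

Lemma coef_functional_wide (K : comNzRingType) (m : nat -> K) n (p : {poly K}) :
  (size p <= n)%N -> coef_functional m p = \sum_(k < n) p`_k * m k.
Proof.
move=> pn; rewrite /coef_functional (big_ord_widen _ (fun k => p`_k * m k) pn).
rewrite big_mkcond; apply: eq_bigr => k _.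
by case: ltnP => // /(nth_default 0) ->; rewrite mul0r.
Qed.

Lemma coef_functional_is_scalar (K : comNzRingType) (m : nat -> K) :
  scalar (coef_functional m).
Proof.
move=> a p q.
rewrite !(coef_functional_wide m (n := maxn (size (a *: p + q)) (maxn (size p) (size q))))
  ?leq_max ?leqnn ?orbT //.
rewrite mulr_sumr -big_split /=; apply: eq_bigr => k _.
by rewrite coefD coefZ mulrDl mulrA.
Qed.

HB.instance Definition _ (K : comNzRingType) (m : nat -> K) :=
  GRing.isLinear.Build K {poly K} K *%R (coef_functional m)
    (coef_functional_is_scalar m).

Lemma coef_functionalC (K : comNzRingType) (m : nat -> K) (a : K) :
  coef_functional m a%:P = a * m 0%N.
Proof.
by rewrite (coef_functional_wide m (n := 1)) ?size_polyC_leq1 // big_ord1 coefC.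
Qed.

Section RePoly.
Variable R : rcfType.
Implicit Types P : {poly R[i]}.

Definition Re_poly P : {poly R} := map_poly (@complex.Re R) P.

Lemma coef_Re_poly P k : (Re_poly P)`_k = complex.Re P`_k.
Proof. by rewrite coef_map_id0. Qed.

Lemma size_Re_poly P : (size (Re_poly P) <= size P)%N.
Proof. exact: size_poly. Qed.

Lemma Re_sum n (F : 'I_n -> R[i]) :
  complex.Re (\sum_(k < n) F k) = \sum_(k < n) complex.Re (F k).
Proof. by apply: (big_morph (@complex.Re R)) => // -[a b] [c d]. Qed.

Lemma Re_mulr_real (z : R[i]) (a : R) : complex.Re (z * a%:C) = complex.Re z * a.
Proof. by case: z => x y /=; rewrite mulr0 subr0. Qed.

Lemma horner_Re_poly P (x : R) : (Re_poly P).[x] = complex.Re P.[x%:C].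
Proof.
rewrite (horner_coef_wide _ (size_Re_poly P)) horner_coef Re_sum.
by apply: eq_bigr => k _; rewrite coef_Re_poly -(rmorphXn (real_complex R)) Re_mulr_real.
Qed.

Lemma deriv_Re_poly P : deriv (Re_poly P) = Re_poly (deriv P).
Proof.
apply/polyP => k; rewrite coef_deriv !coef_Re_poly coef_deriv.
rewrite -mulr_natr -[P`_k.+1 *+ _]mulr_natr -(rmorph_nat (real_complex R)).
by rewrite Re_mulr_real.
Qed.

Lemma Re_coef_functional (m : nat -> R) P :
  complex.Re (coef_functional (fun k => (m k)%:C) P) =
  coef_functional m (Re_poly P).
Proof.
rewrite (coef_functional_wide _ (size_Re_poly P)) Re_sum.
by apply: eq_bigr => k _; rewrite Re_mulr_real coef_Re_poly.
Qed.

Lemma conjc_coef_functional (m : nat -> R) P :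
  (coef_functional (fun k => (m k)%:C) P)^* =
  coef_functional (fun k => (m k)%:C) (map_poly conjc P).
Proof.
rewrite /coef_functional size_map_poly rmorph_sum; apply: eq_bigr => k _.
rewrite rmorphM coef_map /=; congr (_ * _); exact: conjc_real.
Qed.

End RePoly.

Section Moments.
Variables (R : realType) (g : R -> R).
Notation mu := (@lebesgue_measure R).
Hypothesis g_integrable : mu.-integrable (`[0, 1] : set R) (EFin \o g).

Definition moment (k : nat) : R :=
  Rintegral mu (`[0, 1] : set R) (fun t => t ^+ k * g t).

Definition moment_functional : {poly R[i]} -> R[i] :=
  coef_functional (fun k => (moment k)%:C).

HB.instance Definition _ := GRing.Linear.on moment_functional.

Lemma integrable_horner_mul (q : {poly R}) :
  mu.-integrable (`[0, 1] : set R) (EFin \o (fun t => q.[t] * g t)).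
Proof.
apply: (integrable_mul_bounded (M := \sum_(k < size q) `|q`_k|)) => //.
  exact: measurable_poly.
by move=> x; rewrite /= in_itv; exact: normr_horner_le.
Qed.

(** Stated for a coefficient sequence so as to serve both polynomials and Taylor partial sums of the
    cosine. *)
Lemma Rintegral_sum_exp n (a : nat -> R) :
  Rintegral mu (`[0, 1] : set R) (fun t => (\sum_(k < n) a k * t ^+ k) * g t) =
  \sum_(k < n) a k * moment k.
Proof.
have iX k : mu.-integrable (`[0, 1] : set R) (EFin \o (fun t => t ^+ k * g t)).
  apply: (eq_integrable _ _ _ _ (integrable_horner_mul 'X^k)) => // x _ /=.
  by rewrite hornerXn.
elim: n => [|n IH].
  rewrite big_ord0; under eq_Rintegral do rewrite big_ord0 mul0r.
  by rewrite Rintegral_cst // mul0r.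
under eq_Rintegral do rewrite big_ord_recr /= mulrDl -mulrA.
rewrite RintegralD //; last 2 first.
- apply: (eq_integrable _ _ _ _ (integrable_horner_mul (\poly_(k < n) a k))) => // x _ /=.
  by rewrite horner_poly.
- by have := integrableZl _ (a n) (iX n); apply.
by rewrite IH RintegralZl // big_ord_recr.
Qed.

Lemma Rintegral_horner_mul (q : {poly R}) :
  Rintegral mu (`[0, 1] : set R) (fun t => q.[t] * g t) =
  coef_functional moment q.
Proof.
by under eq_Rintegral do rewrite horner_coef; rewrite Rintegral_sum_exp.
Qed.

Lemma integrable_oo01 : mu.-integrable (`]0, 1[ : set R) (EFin \o g).
Proof. by apply: integrableS g_integrable => //; exact: subset_itv_oo_cc. Qed.

Hypothesis g_ge0 : forall t : R, 0 < t < 1 -> 0 <= g t.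
Hypothesis g_nondecreasing :
  forall s t : R, 0 < s -> s <= t -> t < 1 -> g s <= g t.

(** The inequality on []0, 1[] passes to [[0, 1]]: the endpoints, where [g] may have any value, form
    a null set. *)
Lemma coef_functional_deriv_ge0 (q : {poly R}) :
  (forall s, 0 <= s <= 1 -> q.[s] <= q.[1]) ->
  0 <= coef_functional moment (deriv q).
Proof.
move=> q1; rewrite -Rintegral_horner_mul /Rintegral fine_ge0 //.
have := integral_deriv_monotone_ge0 integrable_oo01 g_ge0 g_nondecreasing q1.
have mq (I : set R) : I `<=` `[0, 1] -> measurable I ->
    measurable_fun I (EFin \o (fun t => (deriv q).[t] * g t)).
  move=> I01 mI; apply: measurable_int (_ : mu.-integrable I _).
  by apply: integrableS (integrable_horner_mul (deriv q)).
by rewrite integral_itv_bndo_bndc ?integral_itv_obnd_cbnd //; apply: mq => //;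
  apply: subset_itv; rewrite bnd_simp.
Qed.

End Moments.

(* [r] and [s] are the distances of [1] and [t] to a point of abscissa [x]. *)
Lemma power_gap (R : realFieldType) (r s t x : R) k : 0 < r -> 0 <= s ->
  0 <= t <= 1 -> x < 2^-1 -> r ^+ 2 - s ^+ 2 = (1 - t) * (1 + t - 2 * x) ->
  (1 - t) * (r ^+ k.+1 * r ^+ k * (1 - 2 * x) / (2 * r)) <=
  r ^+ k.+1 * r ^+ k.+1 - r ^+ k.+1 * s ^+ k.+1.
Proof.
move=> r0 s0 /andP[t0 t1] x2 rs.
have x2' : 0 < 1 - 2 * x by lra.
have sr : s <= r.
  rewrite -(ler_pXn2r (n := 2)) ?nnegrE ?(ltW r0) // -subr_ge0 rs.
  by rewrite mulr_ge0 //; lra.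
(* [r - s = (r^2 - s^2)/(r + s)], with [r + s <= 2 r] and [1 + t - 2 x >= 1 - 2 x]. *)
have h1 : (1 - t) * (1 - 2 * x) / (2 * r) <= r - s.
  rewrite ler_pdivrMr ?mulr_gt0 //; nra.
have h2 : r ^+ k * (r - s) <= r ^+ k.+1 - s ^+ k.+1.
  rewrite mulrBr -exprSr lerD2l lerN2 exprSr ler_wpM2r //.
  by rewrite lerXn2r ?nnegrE ?(ltW r0).
rewrite -mulrBr.
apply: (le_trans (y := r ^+ k.+1 * (r ^+ k * (r - s)))); last first.
  by rewrite ler_wpM2l // exprn_ge0 // ltW.
rewrite [leLHS](_ : _ =
  r ^+ k.+1 * r ^+ k * ((1 - t) * (1 - 2 * x) / (2 * r))); last by ring.
by rewrite mulrA ler_wpM2l // mulr_ge0 // exprn_ge0 // ltW.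
Qed.

Section PowerFunctional.
Variables (R : realType) (g : R -> R).
Notation mu := (@lebesgue_measure R).
Hypothesis g_integrable : mu.-integrable (`[0, 1] : set R) (EFin \o g).
Hypothesis g_ge0 : forall t : R, 0 < t < 1 -> 0 <= g t.
Hypothesis g_nondecreasing :
  forall s t : R, 0 < s -> s <= t -> t < 1 -> g s <= g t.

(* With [u := 1 - tau], the real part of [conj (u^(k+1)) * (X - tau)^(k+1)]
   attains its maximum over [0, 1] at [1]; the term [c * 'X] makes room for a
   strict inequality. *)
Lemma nonvanishing_powers_moment_functional : 0 < moment g 0 ->
  nonvanishing_powers 2^-1 (moment_functional g).
Proof.
move=> m0 k tau tau2; apply/negP => /eqP Phi0.
pose u : R[i] := 1 - tau; pose w := (u ^+ k.+1)^*.
pose r (z : R[i]) : R := Num.sqrt (complex.Re z ^+ 2 + complex.Im z ^+ 2).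
have rE z : `|z| = (r z)%:C by exact: normc_def.
have r_sqr z : r z ^+ 2 = complex.Re z ^+ 2 + complex.Im z ^+ 2.
  by rewrite sqr_sqrtr // addr_ge0 // sqr_ge0.
have r_ge0 z : 0 <= r z by exact: sqrtr_ge0.
have ru : 0 < r u.
  rewrite sqrtr_gt0; apply: ltr_pwDl; last exact: sqr_ge0.
  rewrite exprn_even_gt0 //=; apply/negP => /eqP.
  by rewrite /u; case: (tau) tau2 => a b /=; lra.
(* [c] is the slope furnished by [power_gap] for distance [|u|] and abscissa [Re tau]. *)
pose c : R := r u ^+ k.+1 * r u ^+ k * (1 - 2 * complex.Re tau) / (2 * r u).
have c0 : 0 < c.
  rewrite /c divr_gt0 ?mulr_gt0 ?exprn_gt0 //; lra.
pose P : {poly R[i]} := w *: ('X - tau%:P) ^+ k.+1 - c%:C *: 'X.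
have PE (s : R) : complex.Re P.[s%:C] =
    complex.Re (w * (s%:C - tau) ^+ k.+1) - c * s.
  rewrite /P hornerD hornerN !hornerZ horner_exp hornerXsubC hornerX -rmorphM.
  by case: (w * _) => a b.
have P1 s : 0 <= s <= 1 -> (Re_poly P).[s] <= (Re_poly P).[1].
  move=> s01; rewrite !horner_Re_poly !PE.
  (* At [s = 1] the product is [conj (u^(k+1)) * u^(k+1)], so the modulus bound [Re_le] is attained
     there. *)
  have -> : complex.Re (w * (1%:C - tau) ^+ k.+1) = r u ^+ k.+1 * r u ^+ k.+1.
    rewrite /w -/u mulrC -sqr_normc normrX rE -!rmorphXn /=; ring.
  have Re_le : complex.Re (w * (s%:C - tau) ^+ k.+1) <=
      r u ^+ k.+1 * r (s%:C - tau) ^+ k.+1.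
    apply: le_trans (ler_norm _) _; rewrite -lecR; apply: le_trans (normc_ge_Re _) _.
    by rewrite normrM /w normcJ !normrX !rE -!rmorphXn -rmorphM.
  have rs : r u ^+ 2 - r (s%:C - tau) ^+ 2 =
      (1 - s) * (1 + s - 2 * complex.Re tau).
    by rewrite !r_sqr /u; case: (tau) => a b /=; ring.
  have := power_gap k ru (r_ge0 _) s01 tau2 rs; rewrite -/c => gap.
  by lra.
have := coef_functional_deriv_ge0 g_integrable g_ge0 g_nondecreasing P1.
rewrite deriv_Re_poly -Re_coef_functional -/(moment_functional g).
have -> : deriv P = (w * k.+1%:R) *: ('X - tau%:P) ^+ k - c%:C%:P.
  rewrite /P derivB !derivZ deriv_exp derivXsubC derivX mul1r alg_polyC.
  by rewrite -scaler_nat scalerA.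
(* Once [Phi((X - tau)^k) = 0], only the constant term of the derivative is left: [0 <= - c * m_0],
   which is absurd. *)
rewrite linearB linearZ /= Phi0 mulr0 sub0r.
rewrite /moment_functional coef_functionalC -rmorphM /= oppr_ge0 leNgt.
by rewrite mulr_gt0.
Qed.

End PowerFunctional.

(** * Taylor coefficients *)

(** An asymptotic expansion to all orders at 0 from the right: it determines the coefficients and is
    easily estimated under an integral. *)
Definition taylor_at0 (R : realType) (F : R -> R) (a : nat -> R) : Prop :=
  exists2 e : R, 0 < e & forall N, exists C : R, forall x, 0 < x <= e ->
    `|F x - \sum_(k < N) a k * x ^+ k| <= C * x ^+ N.

(** At the first index [n] where they could differ, [(a_n - b_n) x^n] is [O(x^(n+1))]; divide by
    [x^n] and let [x] shrink. *)
Lemma taylor_at0_unique (R : realType) (F : R -> R) (a b : nat -> R) :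
  taylor_at0 F a -> taylor_at0 F b -> a =1 b.
Proof.
move=> [e e0 Fa] [e' e'0 Fb] n; elim/ltn_ind: n => n IH.
have [C1 H1] := Fa n.+1; have [C2 H2] := Fb n.+1.
apply/eqP; rewrite -subr_eq0 -normr_le0; apply/ler_addgt0Pr => d d0; rewrite add0r.
pose C := 1 + `|C1| + `|C2|.
have C0 : 0 < C by rewrite /C -addrA ltr_pwDl // addr_ge0.
pose x := Num.min (Num.min e e') (d / C).
have x0 : 0 < x by rewrite !lt_min e0 e'0 divr_gt0.
have xe : x <= e by rewrite !ge_min lexx.
have xe' : x <= e' by rewrite !ge_min lexx orbT.
have xd : C * x <= d by rewrite mulrC -ler_pdivlMr // ge_min lexx orbT.
have := H1 x _; rewrite x0 xe => /(_ isT) h1.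
have := H2 x _; rewrite x0 xe' => /(_ isT) h2.
have xn0 : 0 < x ^+ n by rewrite exprn_gt0.
rewrite -(ler_pM2r xn0) -[X in `|_| * X]gtr0_norm // -normrM.
have -> : (a n - b n) * x ^+ n =
    (F x - \sum_(k < n.+1) b k * x ^+ k) - (F x - \sum_(k < n.+1) a k * x ^+ k).
  rewrite !big_ord_recr /=.
  have -> : \sum_(k < n) a k * x ^+ k = \sum_(k < n) b k * x ^+ k.
    by apply: eq_bigr => k _; rewrite IH.
  by ring.
apply: le_trans (ler_normB _ _) _.
apply: (le_trans (lerD h2 h1)); rewrite -mulrDl exprS mulrA ler_wpM2r ?(ltW xn0) //.
apply: le_trans _ xd; rewrite ler_wpM2r ?(ltW x0) //.
by have := ler_norm C1; have := ler_norm C2; rewrite /C; lra.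
Qed.

(** Comparison with a geometric series of ratio [|x| <= 1/2], whose tail is at most twice its first
    term. *)
Lemma series_tail_le (R : realType) (a : nat -> R) (M S x : R) N :
  (forall k, `|a k| <= M) -> `|x| <= 2^-1 ->
  series (fun k => a k * x ^+ k) @ \oo --> S ->
  `|S - \sum_(k < N) a k * x ^+ k| <= 2 * M * `|x| ^+ N.
Proof.
move=> aM x2 aS.
have M0 : 0 <= M := le_trans (normr_ge0 _) (aM 0%N).
set P := \sum_(k < N) _.
(* The bound telescopes: [M r^j <= 2 M (r^j - r^(j+1))] for [r = |x| <= 1/2]. *)
have partial m : `|series (fun k => a k * x ^+ k) (N + m)%N - P| <=
    2 * M * (`|x| ^+ N - `|x| ^+ (N + m)).
  elim: m => [|m IH].
    by rewrite addn0 /series /= big_mkord -/P !subrr normr0 mulr0.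
  rewrite addnS seriesSr /= addrAC; apply: le_trans (ler_normD _ _) _.
  have xm0 : 0 <= `|x| ^+ (N + m) by rewrite exprn_ge0.
  have : `|a (N + m)%N * x ^+ (N + m)| <= M * `|x| ^+ (N + m).
    by rewrite normrM normrX ler_wpM2r.
  have : M * `|x| ^+ (N + m) * `|x| <= M * `|x| ^+ (N + m) * 2^-1.
    by rewrite ler_wpM2l // mulr_ge0.
  rewrite exprSr; lra.
have nS : `|series (fun k => a k * x ^+ k) n - P| @[n --> \oo] --> `|S - P|.
  by apply: cvg_norm; apply: cvgB => //; exact: cvg_cst.
rewrite -(cvg_lim _ nS) //; apply: limr_le.
  by apply/cvg_ex; eexists; exact: nS.
exists N => // n /= Nn; rewrite -(subnKC Nn); apply: le_trans (partial _) _.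
by rewrite ler_wpM2l ?mulr_ge0 // gerBl exprn_ge0.
Qed.

(** Convergence at [x = 1] bounds the coefficients. *)
Lemma taylor_at0_series (R : realType) (F : R -> R) (a : nat -> R) :
  (forall x, series (fun k => a k * x ^+ k) @ \oo --> F x) -> taylor_at0 F a.
Proof.
move=> aF; exists 2^-1; first by rewrite invr_gt0.
have [M aM] : exists M, forall k, `|a k| <= M.
  have : cvgn (series a).
    apply/cvg_ex; exists (F 1); have := aF 1.
    by under eq_fun do rewrite expr1n mulr1.
  move=> /cvg_series_cvg_0 a0.
  have : cvgn a by apply/cvg_ex; exists 0.
  move=> /cvg_seq_bounded [M [_ /(_ (M + 1))]].
  rewrite ltrDl ltr01 => /(_ isT) aM; exists (M + 1) => k; exact: aM.
move=> N; exists (2 * M) => x /andP[x0 x2].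
have := series_tail_le N aM _ (aF x); rewrite gtr0_norm //; exact.
Qed.

(** [phi] is to be [Re] or [Im]: real-linear and 1-Lipschitz, it carries the complex series on the
    real axis to a real one. *)
Lemma taylor_at0_entire (R : realType) (f : R[i] -> R[i]) (c : nat -> R[i])
    (phi : R[i] -> R) :
  entire_with_coefs f c ->
  {morph phi : z w / z + w} -> phi 0 = 0 ->
  (forall z (x : R), phi (z * x%:C) = phi z * x) ->
  (forall z, (`|phi z|)%:C <= `|z|) ->
  taylor_at0 (fun x => phi (f x%:C)) (phi \o c).
Proof.
move=> fc phiD phi0 phiM phi_le; apply: taylor_at0_series => x.
apply/cvgrPdist_lt => e e0.
have e0' : 0 < e%:C by rewrite ltcR.
have := fc x%:C => /cvgrPdist_lt /(_ _ e0'); apply: filterS => n.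
set s := series _ n => /= sn.
have -> : series (fun k => (phi \o c) k * x ^+ k) n = phi s.
  rewrite /s /series /= (big_morph phi phiD phi0); apply: eq_bigr => k _.
  by rewrite -phiM rmorphXn.
rewrite -ltcR; apply: le_lt_trans sn.
have -> : phi (f x%:C) - phi s = phi (f x%:C - s).
  by apply/eqP; rewrite subr_eq -phiD subrK.
exact: phi_le.
Qed.

Definition cos_taylor (R : realType) (k : nat) : R :=
  (~~ odd k)%:R * (-1) ^+ k./2 / k`!%:R.

Lemma normr_cos_taylor (R : realType) k : `|cos_taylor R k| <= 1.
Proof.
rewrite /cos_taylor !normrM normrX normrN normr1 expr1n mulr1 normfV !ger0_norm //.
rewrite ler_pdivrMr ?ltr0n ?fact_gt0 // mul1r ler_nat.
by apply: leq_trans (leq_b1 _) (fact_gt0 k).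
Qed.

Lemma cos_taylor_le (R : realType) (x : R) N : `|x| <= 2^-1 ->
  `|cos x - \sum_(k < N) cos_taylor R k * x ^+ k| <= 2 * `|x| ^+ N.
Proof.
move=> x2; rewrite -[2]mulr1; apply: series_tail_le => //.
  exact: normr_cos_taylor.
have -> : (fun k => cos_taylor R k * x ^+ k) = cos_coeff x.
  by apply/funext => k; rewrite /cos_taylor /cos_coeff /= -exprnP mulrAC.
by rewrite cos.unlock; exact: is_cvg_series_cos_coeff.
Qed.

Section CosineTransform.
Variables (R : realType) (g : R -> R).
Notation mu := (@lebesgue_measure R).
Hypothesis g_integrable : mu.-integrable (`[0, 1] : set R) (EFin \o g).

(** The Taylor remainder of the cosine is integrated against [|g|]. *)
Lemma taylor_at0_cos_integral (l : R) :
  taylor_at0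
    (fun x => Rintegral mu (`[0, 1] : set R) (fun t => cos (l * x * t) * g t))
    (fun k => cos_taylor R k * l ^+ k * moment g k).
Proof.
(* This radius ensures [|l x t| <= 1/2] for [t] in [[0, 1]], as the remainder estimate for the
   cosine requires. *)
exists (2 * (1 + `|l|))^-1.
  by rewrite invr_gt0 mulr_gt0 // ltr_pwDl.
move=> N; exists (2 * `|l| ^+ N * Rintegral mu (`[0, 1] : set R) (fun t => `|g t|)).
move=> x /andP[x0 xe].
have lx : `|l * x| <= 2^-1.
  rewrite normrM (gtr0_norm x0).
  have : x * (2 * (1 + `|l|)) <= 1.
    by rewrite -ler_pdivlMr ?mul1r // mulr_gt0 // ltr_pwDl.
  by lra.
have -> : \sum_(k < N) cos_taylor R k * l ^+ k * moment g k * x ^+ k =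
    Rintegral mu (`[0, 1] : set R)
      (fun t => (\sum_(k < N) (cos_taylor R k * (l * x) ^+ k) * t ^+ k) * g t).
  rewrite (Rintegral_sum_exp g_integrable N (fun k => cos_taylor R k * (l * x) ^+ k)).
  apply: eq_bigr => k _.
  by rewrite exprMn; ring.
have icos : mu.-integrable (`[0, 1] : set R)
    (EFin \o (fun t => cos (l * x * t) * g t)).
  apply: (integrable_mul_bounded (M := 1)) => //.
    apply: measurable_funTS; apply: continuous_measurable_fun => t.
    apply: continuous_comp; last exact: continuous_cos.
    by apply: cvgM; [exact: cvg_cst|exact: cvg_id].
  by move=> t _; rewrite ler_norml cos_geN1 cos_le1.
have isum : mu.-integrable (`[0, 1] : set R) (EFin \o
    (fun t => (\sum_(k < N) (cos_taylor R k * (l * x) ^+ k) * t ^+ k) * g t)).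
  apply: (eq_integrable _ _ _ _ (integrable_horner_mul g_integrable
    (\poly_(k < N) (cos_taylor R k * (l * x) ^+ k)))) => // t _ /=.
  by rewrite horner_poly.
have idiff := integrableB _ icos isum.
rewrite -RintegralB //.
apply: le_trans (le_normr_Rintegral _ _) _ => //.
  exact: idiff.
rewrite (_ : 2 * `|l| ^+ N * _ * _ = Rintegral mu (`[0, 1] : set R)
    (fun t => 2 * `|l| ^+ N * x ^+ N * `|g t|)); last first.
  rewrite RintegralZl //; last exact: integrable_norm.
  by rewrite mulrAC.
apply: le_Rintegral => //.
- exact: (integrable_norm (idiff _)).
- have := integrableZl _ (2 * `|l| ^+ N * x ^+ N) (integrable_norm g_integrable).
  by apply.
- move=> t; rewrite /= in_itv /= => /andP[t0 t1].
  rewrite -mulrBl normrM ler_wpM2r //.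
  under eq_bigr do rewrite -mulrA -exprMn.
  apply: le_trans (cos_taylor_le _ _) _.
    rewrite normrM (ger0_norm t0); apply: le_trans lx.
    by rewrite ler_piMr.
  rewrite -[leRHS]mulrA ler_wpM2l // -exprMn lerXn2r ?nnegrE ?mulr_ge0 ?(ltW x0) //.
  by rewrite !normrM (gtr0_norm x0) (ger0_norm t0) ler_piMr ?mulr_ge0 ?(ltW x0).
Qed.

End CosineTransform.

(** * The operator *)

Lemma ccos_real (R : realType) (y : R) : ccos y%:C = (cos y)%:C.
Proof.
rewrite /ccos /cexp /= !mul0r !mul1r subr0 oppr0 add0r expR0 cosN sinN.
have two0 : (2 : R[i]) != 0 by rewrite pnatr_eq0.
apply: (mulIf two0); rewrite divfK //.
by apply/eqP; rewrite eq_complex /=; apply/andP; split; apply/eqP; ring.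
Qed.

(** * Coefficients of [f] in terms of the moments of [g] *)

Section Coefficients.
Variables (R : realType) (lambda : R) (f : R[i] -> R[i]) (c : nat -> R[i]) (g : R -> R).
Hypothesis f_entire : entire_with_coefs f c.
Hypothesis g_integrable :
  lebesgue_measure.-integrable (`[0, 1] : set R) (EFin \o g).
Hypothesis f_repr : forall z : R[i],
  f z = Cintegral (`[0, 1] : set R)
          (fun t => ccos (lambda%:C * z * t%:C) * (g t)%:C).

(** On the real axis [f] is the real cosine integral. Comparing expansions there gives [Re c_k], and
    comparing [Im f = 0] with the zero expansion gives [Im c_k = 0]. *)
Lemma coef_cos_integral k :
  c k = (cos_taylor R k * lambda ^+ k * moment g k)%:C.
Proof.
have fE x : f x%:C = (Rintegral lebesgue_measure (`[0, 1] : set R)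
    (fun t => cos (lambda * x * t) * g t))%:C.
  have ccosE t : ccos (lambda%:C * x%:C * t%:C) * (g t)%:C =
      (cos (lambda * x * t) * g t)%:C.
    by rewrite -!rmorphM ccos_real rmorphM.
  rewrite f_repr /Cintegral; congr (_ +i* _).
    by apply: eq_Rintegral => t _; rewrite ccosE.
  under eq_Rintegral do rewrite ccosE /=.
  by rewrite Rintegral_cst // mul0r.
have ReE : (fun x => complex.Re (f x%:C)) =
    (fun x => Rintegral lebesgue_measure (`[0, 1] : set R)
      (fun t => cos (lambda * x * t) * g t)).
  by apply/funext => x; rewrite fE.
have ImE : (fun x => complex.Im (f x%:C)) = (fun=> 0).
  by apply/funext => x; rewrite fE.
have tRe : taylor_at0 (fun x => complex.Re (f x%:C)) ((@complex.Re R) \o c).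
  apply: taylor_at0_entire f_entire _ _ _ _ => //.
  - by move=> [a b] [a' b'].
  - exact: Re_mulr_real.
  - by move=> z; rewrite normc_ge_Re.
have tIm : taylor_at0 (fun x => complex.Im (f x%:C)) ((@complex.Im R) \o c).
  apply: taylor_at0_entire f_entire _ _ _ _ => //.
  - by move=> [a b] [a' b'].
  - by move=> [a b] x /=; rewrite mulr0 add0r.
  - move=> [a b]; rewrite normc_def lecR -sqrtr_sqr ler_wsqrtr //=.
    by rewrite lerDr sqr_ge0.
have t0 : taylor_at0 (fun=> 0 : R) (fun=> 0).
  exists 1 => // N; exists 0 => x _.
  by rewrite big1 ?subrr ?normr0 ?mul0r // => i _; rewrite mul0r.
rewrite ReE in tRe; rewrite ImE in tIm.
have := taylor_at0_unique tRe (taylor_at0_cos_integral g_integrable lambda) k.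
have := taylor_at0_unique tIm t0 k.
by rewrite /=; case: (c k) => a b /= -> ->.
Qed.

End Coefficients.

Lemma comp_poly_affine (K : comNzRingType) (P : {poly K}) (z a : K) :
  P \Po (z%:P + a *: 'X) = \sum_(k < size P) (P^`N(k).[z] * a ^+ k) *: 'X^k.
Proof.
rewrite /comp_poly nderiv_taylor; last exact: mulrC.
rewrite size_map_polyC; apply: eq_bigr => k _.
by rewrite nderivn_map horner_map /= exprZn -scalerA mul_polyC.
Qed.

Lemma coef_functionalXn (K : comNzRingType) (m : nat -> K) k :
  coef_functional m 'X^k = m k.
Proof.
rewrite /coef_functional size_polyXn big_ord_recr /= coefXn eqxx mul1r.
by rewrite big1 ?add0r // => i _; rewrite coefXn ltn_eqF ?mul0r.
Qed.

(** Odd powers cancel and even ones double; this is how the shifts [z + i l X] and [z - i l X]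
    together produce the cosine coefficients. *)
Lemma expr_imaginary (R : rcfType) k :
  ('i : R[i]) ^+ k + (- 'i) ^+ k = 2 * ((~~ odd k)%:R * (-1) ^+ k./2).
Proof.
rewrite -{1 2}(odd_double_half k) !exprD -mul2n !exprM sqrrN sqr_i -mulrDl.
by case: odd; rewrite /= ?expr1 ?expr0 ?subrr ?mul0r ?mulr0 ?mul1r.
Qed.

Section Operator.
Variables (R : realType) (g : R -> R) (l : R).

Definition cos_coef (k : nat) : R := cos_taylor R k * l ^+ k * moment g k.

Lemma diffop_horner (P : {poly R[i]}) (z : R[i]) :
  2 * (diffop (fun k => (cos_coef k)%:C) P).[z] =
  moment_functional g (P \Po (z%:P + ('i * l%:C) *: 'X)) +
  moment_functional g (P \Po (z%:P + (- ('i * l%:C)) *: 'X)).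
Proof.
rewrite !comp_poly_affine !linear_sum -big_split /diffop horner_sum mulr_sumr /=.
apply: eq_bigr => k _; rewrite !linearZ /= hornerZ /moment_functional.
rewrite coef_functionalXn nderivn_def hornerMn -mulrDl -mulrDr.
rewrite -mulNr !exprMn -mulrDl expr_imaginary /cos_coef /cos_taylor.
rewrite !rmorphM !rmorphXn /= rmorphN1 fmorphV !rmorph_nat -mulr_natr.
by field; rewrite pnatr_eq0 -lt0n fact_gt0.
Qed.

Lemma diffop_toC (p : {poly R}) :
  diffop (fun k => (cos_coef k)%:C) (poly_toC p) =
  poly_toC (\sum_(k < size p) cos_coef k *: p^`(k)).
Proof.
rewrite /poly_toC rmorph_sum /diffop size_map_poly; apply: eq_bigr => k _.
by rewrite /= map_polyZ derivn_map.
Qed.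

End Operator.

(** Take [e = conj b / b]; when [b = 0], also [a = 0] and [e = 1] will do. *)
Lemma unimodular_combination (K : numClosedFieldType) (a b : K) :
  a + b^*%R = 0 -> exists2 e : K, `|e| = 1 & a + e * b = 0.
Proof.
move=> ab; have [b0|b0] := eqVneq b 0.
  by exists 1; rewrite ?normr1 // b0 mulr0; move: ab; rewrite b0 conjC0.
exists (b^*%R / b); first by rewrite normf_div norm_conjC mulfV // normr_eq0.
by rewrite divfK.
Qed.

(** * Moments of a monotone weight, and nonvanishing of [f(D)p] *)

Section MonotoneOperator.
Variables (R : realType) (g : R -> R) (mu l : R).
Hypothesis g_integrable :
  lebesgue_measure.-integrable (`[0, 1] : set R) (EFin \o g).
Hypothesis g_ge0 : forall t : R, 0 < t < 1 -> 0 <= g t.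
Hypothesis g_nondecreasing :
  forall s t : R, 0 < s -> s <= t -> t < 1 -> g s <= g t.

Lemma moment_ge0 k : 0 <= moment g k.
Proof.
have q1 s : 0 <= s <= 1 -> ('X^(k.+1) : {poly R}).[s] <= ('X^(k.+1) : {poly R}).[1].
  by move=> /andP[s0 s1]; rewrite !hornerXn expr1n exprn_ile1.
have := coef_functional_deriv_ge0 g_integrable g_ge0 g_nondecreasing q1.
rewrite derivXn -scaler_nat linearZ /= coef_functionalXn.
by rewrite pmulr_rge0 // ltr0n.
Qed.

(** The derivative of [(k+1) X - X^(k+1)] is [(k+1) (1 - X^k)]. Together with nonnegativity, this
    makes every moment vanish as soon as [m_0] does. *)
Lemma moment_le_moment0 k : moment g k <= moment g 0.
Proof.
pose q : {poly R} := k.+1%:R *: 'X - 'X^(k.+1).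
have q1 s : 0 <= s <= 1 -> q.[s] <= q.[1].
  move=> /andP[s0 s1]; rewrite !hornerE expr1n ?mulr1.
  suff : 1 - s ^+ k.+1 <= k.+1%:R * (1 - s) by lra.
  elim: {q} k => [|n IH]; first by rewrite mul1r.
  have sn1 : s ^+ n.+1 <= 1 by rewrite exprn_ile1.
  have : s ^+ n.+1 * (1 - s) <= 1 * (1 - s) by rewrite ler_wpM2r // subr_ge0.
  rewrite -[n.+2%:R]natr1 [s ^+ n.+2]exprSr; lra.
have := coef_functional_deriv_ge0 g_integrable g_ge0 g_nondecreasing q1.
rewrite /q derivB derivZ derivX derivXn -[X in _ - X]scaler_nat -scalerBr linearZ /=.
rewrite linearB /= coef_functionalXn -polyC1 coef_functionalC mul1r.
by rewrite pmulr_rge0 ?ltr0n // subr_ge0.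
Qed.

Hypothesis moment0_gt0 : 0 < moment g 0.
Hypothesis l_gt0 : 0 < l.

Lemma diffop_cos_neq0 (p : {poly R}) (z : R[i]) :
  (1 < size p)%N -> strip_polys mu p -> 0 < complex.Im z ->
  mu ^+ 2 - l ^+ 2 / 4 < complex.Im z ^+ 2 ->
  (diffop (fun k => (cos_coef g l k)%:C) (poly_toC p)).[z] != 0.
Proof.
move=> szp pmu z0 muz; apply/negP => /eqP Dz0.
have := diffop_horner g l (poly_toC p) z; rewrite Dz0 mulr0 => /esym.
set A := poly_toC p \Po (z%:P + _).
pose B := poly_toC p \Po (z^*%:P + ('i * l%:C) *: 'X).
(* As [p] and [l] are real, conjugating the coefficients of [B] turns [conj z] into [z] and [i l]
   into [- i l], which gives the second shift. *)
have <- : map_poly conjc B = poly_toC p \Po (z%:P + - ('i * l%:C) *: 'X).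
  rewrite /B map_comp_poly; congr (_ \Po _).
    rewrite rmorphD /= map_polyC map_polyZ map_polyX /= conjcK.
    congr (_ + _ *: _); apply/eqP.
    by rewrite eq_complex /=; apply/andP; split; apply/eqP; ring.
  apply/polyP => k; rewrite /poly_toC !coef_map /=; exact: conjc_real.
rewrite /moment_functional -conjc_coef_functional -/(moment_functional g).
move=> /unimodular_combination [e e1 AB0].
pose h := A + e *: B.
have Phih : moment_functional g h = 0 by rewrite /h linearD linearZ.
have rooth tau : root h tau -> complex.Re tau < 2^-1.
  move=> /rootP; rewrite hornerD hornerZ => /eqP; rewrite addr_eq0 => /eqP.
  move=> /(congr1 Num.norm); rewrite normrN normrM e1 mul1r.
  rewrite !horner_comp !hornerD !hornerC !hornerZ !hornerX => ABn.
  rewrite ltNge; apply/negP => tau2.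
  (* The arguments of [p] in [A] and [B] are [zeta + i y] and [zeta - i y] with [y = Im z]; since
     [Im zeta = l * Re tau >= l/2], de Bruijn's inequality applies at [zeta]. *)
  pose zeta := (complex.Re z)%:C + 'i * l%:C * tau.
  have Imzeta : complex.Im zeta = l * complex.Re tau.
    by rewrite /zeta; case: (tau) => a b /=; ring.
  have l2 : l / 2 <= complex.Im zeta by rewrite Imzeta ler_wpM2l // ltW.
  have zeta0 : 0 < complex.Im zeta by apply: lt_le_trans l2; rewrite divr_gt0.
  have sq : (l / 2) ^+ 2 <= complex.Im zeta ^+ 2.
    by rewrite lerXn2r ?nnegrE ?(ltW zeta0) // ltW // divr_gt0.
  have muzeta : mu ^+ 2 < complex.Im zeta ^+ 2 + complex.Im z ^+ 2.
    by move: sq muz; lra.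
  have := normC_toC_lt szp pmu zeta0 z0 muzeta.
  have -> : zeta - 'i * (complex.Im z)%:C = z^* + 'i * l%:C * tau.
    by rewrite /zeta; case: (z) (tau) => a b [u v]; apply/eqP;
      rewrite eq_complex /=; apply/andP; split; apply/eqP; ring.
  have -> : zeta + 'i * (complex.Im z)%:C = z + 'i * l%:C * tau.
    by rewrite /zeta; case: (z) (tau) => a b [u v]; apply/eqP;
      rewrite eq_complex /=; apply/andP; split; apply/eqP; ring.
  by rewrite ABn ltxx.
(* Otherwise [1/2] would be a root of [h], outside the open half-plane. *)
have h0 : h != 0.
  apply/negP => /eqP h0; have := rooth 2^-1%:C.
  by rewrite h0 root0 ltxx => /(_ isT).
have := scalar_neq0_of_roots (nonvanishing_powers_moment_functional
  g_integrable g_ge0 g_nondecreasing moment0_gt0) h0 rooth.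
by move=> /negP; apply; apply/eqP; exact: Phih.
Qed.

End MonotoneOperator.

(** * Evenness in [lambda], degenerate cases and conclusion *)

Lemma cos_taylor_normr (R : realType) (x : R) k :
  cos_taylor R k * x ^+ k = cos_taylor R k * `|x| ^+ k.
Proof.
have [ok|ek] := boolP (odd k); first by rewrite /cos_taylor ok !mul0r.
by congr (_ * _); rewrite -normrX ger0_norm // exprn_even_ge0.
Qed.

Theorem theorem1p11 (R : realType) (mu lambda : R)
    (f : R[i] -> R[i]) (c : nat -> R[i]) (g : R -> R)
    (mu_ge0 : 0 <= mu)
    (f_entire : entire_with_coefs f c)
    (g_integrable :
      lebesgue_measure.-integrable (`[0, 1] : set R) (EFin \o g))
    (g_ge0 : forall t : R, 0 < t < 1 -> 0 <= g t)
    (g_nondecreasing : forall s t : R, 0 < s -> s <= t -> t < 1 -> g s <= g t)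
    (f_repr : forall z : R[i],
      f z = Cintegral (`[0, 1] : set R)
              (fun t => ccos (lambda%:C * z * t%:C) * (g t)%:C)) :
  let delta := Num.sqrt (Num.max (mu ^+ 2 - lambda ^+ 2 / 4) 0) in
  forall p : {poly R}, strip_polys mu p ->
    exists2 q : {poly R},
      (strip_polys delta `|` [set 0]) q & diffop c (poly_toC p) = poly_toC q.
Proof.
move=> delta p pmu; have [p0 proots] := pmu.
(* Only even powers of [lambda] occur, so it may be replaced by [|lambda|], which is positive once
   [lambda] is nonzero. *)
have cE : c = fun k => (cos_coef g `|lambda| k)%:C.
  apply/funext => k; rewrite (coef_cos_integral f_entire g_integrable f_repr).
  by rewrite /cos_coef cos_taylor_normr.
exists (\sum_(k < size p) cos_coef g `|lambda| k *: p^`(k)); last first.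
  by rewrite cE diffop_toC.
set q := \sum_(k < _) _.
have qE : poly_toC q = diffop c (poly_toC p) by rewrite cE diffop_toC.
have [q0|q0] := eqVneq q 0; [by right|left; split => // z].
have szp1 : (0 < size p)%N by rewrite size_poly_gt0.
(* Serves the two degenerate cases, [lambda = 0] and [p] constant, where [q] is a scalar multiple of
   [p]. *)
have qp0 a : q = a *: p -> a != 0 /\ root (poly_toC p) z = root (poly_toC q) z.
  move=> qa; have a0 : a != 0.
    by apply/negP => /eqP a0; move: q0; rewrite qa a0 scale0r eqxx.
  by split=> //; rewrite qa /poly_toC map_polyZ rootZ // fmorph_eq0.
(* If [m_0 = 0], all moments vanish and [q = 0], contrary to [q0]. *)
have m0 : moment g 0 != 0.
  apply/negP => /eqP m0; move: q0; rewrite /q big1 ?eqxx // => k _.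
  have /eqP -> : cos_coef g `|lambda| k == 0; last by rewrite scale0r.
  rewrite /cos_coef mulf_eq0; apply/orP; right; rewrite eq_le.
  rewrite moment_ge0 // -m0 andbT; exact: moment_le_moment0.
have m0_gt0 : 0 < moment g 0 by rewrite lt_neqAle eq_sym m0 moment_ge0.
(* For [lambda = 0] only index 0 survives: [f(D)] multiplies by a constant, and [delta = mu]. *)
have [lambda0|lambda0] := eqVneq lambda 0.
  have [] // := qp0 (cos_coef g `|lambda| 0).
    rewrite /q; case: (size p) szp1 => // n _; rewrite big_ord_recl derivn0.
    rewrite big1 ?addr0 // => k _.
    by rewrite /cos_coef lambda0 normr0 exprS mul0r mulr0 mul0r scale0r.
  move=> _ <- /proots; rewrite /delta lambda0 expr0n /= mul0r subr0.
  by rewrite max_l ?sqr_ge0 // sqrtr_sqr (ger0_norm mu_ge0).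
have [szp|szp] := leqP (size p) 1.
  have [] // := qp0 (cos_coef g `|lambda| 0).
    have /eqP szp2 : size p == 1%N by rewrite eqn_leq szp.
    by rewrite /q szp2 big_ord1 derivn0.
  have /size_poly1P[a a0 ->] : size p == 1%N by rewrite eqn_leq szp.
  by move=> _ <-; rewrite /poly_toC map_polyC rootC fmorph_eq0 (negbTE a0).
(* [q] is real, so its roots are symmetric about the real axis. *)
wlog z0 : z {qp0} / 0 <= complex.Im z.
  move=> H; have [/H//|z0] := leP 0 (complex.Im z).
  rewrite -root_toC_conj => /H.
  have -> : complex.Im z^* = - complex.Im z by case: (z).
  by rewrite normrN; apply; rewrite oppr_ge0 ltW.
move=> qz; rewrite (ger0_norm z0) leNgt; apply/negP => zdelta.
have z_gt0 : 0 < complex.Im z by apply: le_lt_trans zdelta; exact: sqrtr_ge0.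
have muz : mu ^+ 2 - `|lambda| ^+ 2 / 4 < complex.Im z ^+ 2.
  rewrite real_normK ?num_real //.
  (* [delta^2] is the maximum itself, so it bounds [mu^2 - lambda^2/4] also when that is
     negative. *)
  apply: (@le_lt_trans _ _ (delta ^+ 2)).
    by rewrite sqr_sqrtr le_max ?lexx ?orbT.
  by rewrite ltrXn2r ?nnegrE ?sqrtr_ge0.
have l0 : 0 < `|lambda| by rewrite normr_gt0.
have := diffop_cos_neq0 g_integrable g_ge0 g_nondecreasing m0_gt0 l0 szp pmu
  z_gt0 muz.
by rewrite -cE -qE -rootE qz.
Qed.
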